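(* Let $n,k$ be positive integers with \[ \frac{n}{\log n}\leqslant k\leqslant \frac{2n}{\log n+6} \] (equivalently $\frac{1}{\log n}\leqslant \lambda\leqslant \frac{2}{e^3}\cdot\frac{\sqrt n}{\log n+6}$). Then for any fixed integer $s\geqslant 1$, \[ S(n,k)=\left(1-\frac{\lambda}{k}\right)^k\left(1+\sum_{1\leqslant j<s}\binom{k}{j}(-\Lambda)^jD_{n,k}(j)+O\left(\left(\frac{\lambda\log n}{\sqrt n}\right)^s\right)\right), \] where the implied constant depends only on $s$.
   Context: $\left\{ n \atop k\right\}$ is the Stirling number of the second kind, and $S(n,k):=\left\{ n \atop k\right\}\frac{k!}{k^n}=\sum_{0\leqslant j\leqslant k}\binom{k}{j}(-1)^j\left(1-\frac jk\right)^n$. Put $\lambda:=ke^{-n/k}$, $\Lambda:=\frac{e^{-n/k}}{1-e^{-n/k}}=\frac{\lambda}{k-\lambda}$, and for integers $0\leqslant j\leqslant k$, \[ D_{n,k}(j):=\sum_{0\leqslant l\leqslant j}\binom{j}{l}(-1)^{j-l}\left(e^{l/k}\left(1-\frac{l}{k}\right)\right)^n. \] $\log$ is the natural logarithm. *)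

(* Defs.v *)
From HB Require Import structures.
From mathcomp Require Import all_boot all_order all_algebra.
From mathcomp Require Import all_classical all_reals all_analysis.

Set Implicit Arguments.
Unset Strict Implicit.
Unset Printing Implicit Defensive.

Import Order.TTheory GRing.Theory Num.Theory.

Local Open Scope ring_scope.

(* Stirling number of the second kind: the number of partitions of an n-element
   set into k nonempty blocks (blocks of a [partition] are nonempty). *)
Definition stirling2 (n k : nat) : nat :=
  #|[set P : {set {set 'I_n}} | finset.partition P [set: 'I_n] & #|P| == k]|.

Section Quantities.
Context {R : realType}.

Definition surj_prob (n k : nat) : R :=
  (stirling2 n k)%:R * (k`!)%:R / k%:R ^+ n.

Definition lam (n k : nat) : R := k%:R * expR (- (n%:R / k%:R)).

Definition Lam (n k : nat) : R :=
  expR (- (n%:R / k%:R)) / (1 - expR (- (n%:R / k%:R))).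

Definition Dnk (n k j : nat) : R :=
  \sum_(0 <= l < j.+1)
    ('C(j, l))%:R * (-1) ^+ (j - l) *
    (expR (l%:R / k%:R) * (1 - l%:R / k%:R)) ^+ n.

(* At n = 1 the left inequality is meaningless on paper (log 1 = 0); here the
   right one fails there for every k >= 1. *)
Definition in_range (n k : nat) : Prop :=
  n%:R / ln n%:R <= k%:R :> R /\
  k%:R <= 2 * n%:R / (ln n%:R + 6) :> R.

Definition lam_in_range (n k : nat) : Prop :=
  1 / ln n%:R <= lam n k /\
  lam n k <= 2 / expR 1 ^+ 3 * (Num.sqrt n%:R / (ln n%:R + 6)).

End Quantities.

Arguments in_range R n k : clear implicits.
Arguments lam_in_range R n k : clear implicits.

(* Main.v *)
Require Import Defs.
From HB Require Import structures.
From mathcomp Require Import all_boot all_order all_algebra.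
From mathcomp Require Import all_classical all_reals all_analysis.
From mathcomp Require Import ring lra.

Set Implicit Arguments.
Unset Strict Implicit.
Unset Printing Implicit Defensive.

Import Order.TTheory GRing.Theory Num.Theory.

Local Open Scope ring_scope.

(* Put q = e^(-n/k), g(l) = (e^(l/k) (1 - l/k))^n and d = log n / sqrt n.
   Inclusion-exclusion gives S(n,k) = sum_l C(k,l) (-q)^l g(l); re-expanding g
   in its finite differences D(j) at 0 gives the exact identity
   S(n,k) = (1 - q)^k sum_(j <= k) C(k,j) (-Lam)^j D(j).  So the error is the
   part of this sum with j >= s, and it is enough to bound its j-th term by
   (c x)^j, where x = lam d, c = 7e/3 and c x < 1 (the upper bound on k gives
   x <= 2/e^3).  Since C(k,j) Lam^j is at most (7/6 lam)^j / j!, there are two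
   regimes.  If j d <= 1, then D(j) is a value of the j-th derivative of g on
   [0, j], and the differential equation (1 - y/k) g' = - (n/k^2) y g bounds
   it by (3 d)^j j!.  If j d > 1, then |D(j)| <= 2^j and j! >= (j/e)^j suffice,
   because 1/j < d. *)

(** * Counting functions by the partition into their fibres *)

Lemma preim_partition_pblockE (T : finType) (rT : eqType) (f : T -> rT)
    (P : {set {set T}}) :
  finset.partition P [set: T] ->
  (preim_partition f [set: T] == P) =
  [forall x, forall y, (f x == f y) == (finset.pblock P x == finset.pblock P y)].
Proof.
move=> partP; have [/eqP covP tiP _] := and3P partP.
apply/eqP/'forall_forallP => [defP x y|fP].
  rewrite finset.eq_pblock ?covP ?inE // -defP pblock_equivalence_partition ?inE //.
  by split=> // /eqP ->.
rewrite -[RHS](preim_partition_pblock partP).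
apply: eq_imset => x; apply/setP => y; rewrite !inE /=.
by apply: (elimT eqP); exact: fP.
Qed.

(** A function whose fibres are the blocks of [P] is the same as an injection from the set of blocks
    to [rT]. *)
Lemma card_kernel_partition (T rT : finType) (P : {set {set T}}) :
  finset.partition P [set: T] ->
  #|[set f : {ffun T -> rT} | preim_partition f [set: T] == P]|
    = (#|rT| ^_ #|P|)%N.
Proof.
move=> partP; have [/eqP covP tiP P0] := and3P partP.
have blkP x : finset.pblock P x \in P by rewrite finset.pblock_mem ?covP ?inE.
pose blk x : {B | B \in P} := exist _ (finset.pblock P x) (blkP x).
have rep_ex (B : {B | B \in P}) : exists x, x \in val B.
  by apply/set0Pn; apply: contraNneq P0 => <-; exact: valP.
pose rep B := xchoose (rep_ex B).
have repK : cancel rep blk.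
  by move=> B; apply/val_inj/(finset.def_pblock tiP (valP B))/(xchooseP (rep_ex B)).
pose phi (h : {ffun {B | B \in P} -> rT}) := [ffun x => h (blk x)].
have phi_inj : injective phi.
  move=> h1 h2 /ffunP eqh; apply/ffunP => B.
  by have := eqh (rep B); rewrite !ffunE repK.
have cardP : #|{: {B | B \in P}}| = #|P| by rewrite card_sig; apply: eq_card.
rewrite -cardP -card_inj_ffuns -(card_imset _ phi_inj).
apply: eq_card => f; rewrite inE preim_partition_pblockE //.
apply/'forall_forallP/imsetP => [fP|[h]].
  have eq_f x y : (f x == f y) = (blk x == blk y).
    by rewrite -val_eqE; apply: (elimT eqP); exact: fP.
  exists [ffun B => f (rep B)]; last first.
    by apply/ffunP => x; rewrite !ffunE; apply/eqP; rewrite eq_f repK.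
  rewrite inE; apply/injectiveP => B1 B2; rewrite !ffunE => /eqP.
  by rewrite eq_f !repK => /eqP.
rewrite inE => /injectiveP h_inj -> x y.
by rewrite !ffunE (inj_eq h_inj) -val_eqE.
Qed.

(** Sort the functions from ['I_n] to ['I_k] by their fibre partition, then the partitions by their
    number [j] of blocks. *)
Lemma expn_stirling2 (n k : nat) :
  (k ^ n = \sum_(0 <= j < k.+1) 'C(k, j) * (j`! * stirling2 n j))%N.
Proof.
pose parts := [set P : {set {set 'I_n}} | finset.partition P [set: 'I_n]].
transitivity (\sum_(P in parts) k ^_ #|P|)%N.
  rewrite -[in LHS](card_ord n) -[k in LHS]card_ord -card_ffun -cardsT -sum1_card.
  rewrite (partition_big
    (fun f : {ffun 'I_n -> 'I_k} => preim_partition f [set: 'I_n])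
    (mem parts)) /=; last by move=> f _; rewrite inE preim_partitionP.
  apply: eq_bigr => P; rewrite inE => partP.
  rewrite -[X in X ^_ _]card_ord -card_kernel_partition // sum1dep_card.
  by apply: eq_card => f; rewrite !inE.
(* Partitions with more than [k] blocks contribute 0, the falling factorial being 0. *)
rewrite (bigID (fun P : {set {set 'I_n}} => #|P| < k.+1)%N) /= [X in (_ + X)%N]big1.
  rewrite addn0 (partition_big (fun P : {set {set 'I_n}} => inord #|P| : 'I_k.+1)
    predT) //= big_mkord.
  apply: eq_bigr => j _; rewrite mulnA bin_ffact mulnC -sum_nat_const.
  apply: eq_big => [P|P /andP[/andP[_ ltP] /eqP <-]]; last by rewrite inordK.
  rewrite !inE -andbA; congr andb; apply/andP/eqP => [[ltP /eqP <-]|->].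
    by rewrite inordK.
  by rewrite ltn_ord inord_val.
by move=> P /andP[_]; rewrite -leqNgt => /ffact_small.
Qed.

(** * Binomial transforms and their inversion *)

Lemma coef_exp_linear (A : comNzRingType) (a b : A) (n i : nat) :
  ((a%:P + b *: 'X) ^+ n)`_i = 'C(n, i)%:R * a ^+ (n - i) * b ^+ i.
Proof.
rewrite exprDn coef_sum.
under eq_bigr => j _ do
  rewrite exprZn -rmorphXn /= coefMn coefCM coefZ coefXn.
have [lin|ltni] := ltnP i n.+1.
  rewrite (bigD1 (Ordinal lin)) //= eqxx big1 => [|j neq_j].
    by rewrite addr0 mulr1 -[LHS]mulr_natl mulrA.
  have /negPf-> : i != j by apply: contraNneq neq_j => eq_ij; apply/eqP/val_inj.
  by rewrite !mulr0 mul0rn.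
rewrite bin_small // mul0r mul0r big1 // => j _.
by rewrite gtn_eqF ?mulr0 ?mul0rn // (leq_trans (ltn_ord j)).
Qed.

(* Both sides are the value at [(a + b (c + X))^k] of the linear functional on
   polynomials sending [X^i] to [u i]. *)
Lemma binomial_transform_comp (A : comNzRingType) (u : nat -> A) (a b c : A)
    (k : nat) :
  \sum_(0 <= j < k.+1) 'C(k, j)%:R * a ^+ (k - j) * b ^+ j *
    (\sum_(0 <= i < j.+1) 'C(j, i)%:R * c ^+ (j - i) * u i) =
  \sum_(0 <= i < k.+1) 'C(k, i)%:R * (a + b * c) ^+ (k - i) * b ^+ i * u i.
Proof.
transitivity (\sum_(i < k.+1) ((a%:P + b *: (c%:P + 'X)) ^+ k)`_i * u i); last first.
  rewrite big_mkord; apply: eq_bigr => i _.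
  by rewrite scalerDr addrA -mul_polyC -polyCM -polyCD coef_exp_linear.
rewrite exprDn big_mkord.
under [RHS]eq_bigr => i _ do rewrite coef_sum mulr_suml.
rewrite exchange_big /=; apply: eq_bigr => j _.
rewrite mulr_sumr (big_nat_widen _ _ k.+1) // big_mkord big_mkcond.
apply: eq_bigr => i _ /=.
rewrite exprZn -rmorphXn /= coefMn coefCM coefZ -(scale1r 'X) coef_exp_linear.
rewrite expr1n mulr1 -[X in _ = X * _]mulr_natl !mulrA.
by case: ltnP => // ltji; rewrite (bin_small ltji) mulr0 !mul0r.
Qed.

(** Binomial inversion of [expn_stirling2]: for [a = -1], [b = c = 1] the base [a + b * c] is 0, so
    only the term [i = k] survives. *)
Lemma stirling2_sum (A : comNzRingType) (n k : nat) :
  (stirling2 n k)%:R * (k`!)%:R =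
  \sum_(0 <= j < k.+1) 'C(k, j)%:R * (-1) ^+ (k - j) * j%:R ^+ n :> A.
Proof.
have := binomial_transform_comp (fun j => (j`! * stirling2 n j)%:R : A) (-1) 1 1 k.
rewrite mulr1 addNr [RHS]big_nat_recr //= => binE.
transitivity ((k`! * stirling2 n k)%:R : A); first by rewrite mulnC natrM.
have low0 : \sum_(0 <= i < k) 'C(k, i)%:R * 0 ^+ (k - i) * 1 ^+ i *
    (i`! * stirling2 n i)%:R = 0 :> A.
  rewrite big_nat big1 // => i /= ltik.
  by rewrite expr0n subn_eq0 leqNgt ltik mulr0 !mul0r.
rewrite low0 add0r subnn binn !expr1n !mul1r in binE.
rewrite -binE. apply: eq_bigr => j _; rewrite expr1n mulr1 -natrX.
rewrite expn_stirling2 natr_sum; congr (_ * _); apply: eq_bigr => i _.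
by rewrite expr1n mulr1 -natrM.
Qed.

(** * The exact identity for S(n,k) *)

Section Identity.
Variable R : realType.
Implicit Types n k j : nat.

Lemma surj_prob_sum n k : (0 < k)%N ->
  surj_prob n k =
  \sum_(0 <= j < k.+1) 'C(k, j)%:R * (-1) ^+ j * (1 - j%:R / k%:R) ^+ n :> R.
Proof.
move=> k_gt0; have k_neq0 : k%:R != 0 :> R by rewrite pnatr_eq0 -lt0n.
rewrite /surj_prob stirling2_sum big_nat_rev /= mulr_suml add0n.
apply: eq_big_nat => j /andP[_ ltjk].
rewrite subSS bin_sub // subKn // -[LHS]mulrA -expr_div_n.
by congr (_ * _ ^+ n); rewrite natrB // mulrBl divff.
Qed.

Lemma surj_prob_Dnk n k : (0 < n)%N -> (0 < k)%N ->
  surj_prob n k =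
  (1 - lam n k / k%:R) ^+ k *
  \sum_(0 <= j < k.+1) 'C(k, j)%:R * (- Lam n k) ^+ j * Dnk n k j :> R.
Proof.
move=> n_gt0 k_gt0; have k_neq0 : k%:R != 0 :> R by rewrite pnatr_eq0 -lt0n.
rewrite surj_prob_sum // /lam mulrAC divff // mul1r /Lam.
set q := expR _.
have q_lt1 : q < 1 by rewrite expR_lt1 oppr_lt0 divr_gt0 ?ltr0n.
have q1_neq0 : 1 - q != 0 by rewrite subr_eq0 gt_eqF.
pose g l : R := (expR (l%:R / k%:R) * (1 - l%:R / k%:R)) ^+ n.
transitivity (\sum_(0 <= l < k.+1) 'C(k, l)%:R * (- q) ^+ l * g l).
  (* The exponential factor e^(nl/k) of [g l] cancels [q ^+ l]. *)
  apply: eq_bigr => l _; rewrite [(- q) ^+ l]exprNn -!mulrA; congr (_ * (_ * _)).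
  rewrite /g exprMn -expRM_natr -expRM_natl mulrA -expRD.
  have -> : - (n%:R / k%:R) * l%:R + n%:R * (l%:R / k%:R) = 0 :> R by field.
  by rewrite expR0 mul1r.
(* Here [a + b * c = 1], so one side is the plain sum over [g], while the inner sums on the other
   are the D(j). *)
have := binomial_transform_comp g (1 - q) (- q) (-1) k.
rewrite mulrN1 opprK subrK; under [RHS]eq_bigr => l _ do rewrite expr1n mulr1.
move=> <-; rewrite mulr_sumr; apply: eq_big_nat => j /andP[_ lejk].
have -> : (1 - q) ^+ k = (1 - q) ^+ (k - j) * (1 - q) ^+ j.
  by rewrite -exprD subnK.
rewrite /Dnk -mulNr expr_div_n; field.
by rewrite expf_neq0.
Qed.
End Identity.

(** * Finite differences and derivatives *)

Lemma finite_difference_rec (A : comNzRingType) (u : nat -> A) (j : nat) :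
  \sum_(0 <= l < j.+2) 'C(j.+1, l)%:R * (-1) ^+ (j.+1 - l) * u l =
  \sum_(0 <= l < j.+1) 'C(j, l)%:R * (-1) ^+ (j - l) * (u l.+1 - u l).
Proof.
under [RHS]eq_bigr => l _ do rewrite mulrBr.
rewrite sumrB big_nat_recl // bin0 subn0 mul1r.
under eq_bigr => l _ do rewrite subSS binS natrD 2!mulrDl.
rewrite big_split /= addrA addrC; congr (_ + _).
rewrite [in RHS]big_nat_recl // bin0 subn0 mul1r opprD.
rewrite [X in _ + X]big_nat_recr //= bin_small // !mul0r addr0.
rewrite exprS mulN1r mulNr; congr (_ + _).
rewrite -sumrN; apply: eq_big_nat => l /andP[_ ltlj].
by rewrite -(subnSK ltlj) exprS; ring.
Qed.

Section Analysis.
Import numFieldNormedType.Exports.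
Variable R : realType.

(** Induction on [j]: the unit differences [G i] again form a chain of successive derivatives, and
    the mean value theorem turns [G j] into a value of [F j.+1]. *)
Lemma le_finite_difference (F : nat -> R -> R) (B x : R) (j : nat) :
  (forall i (y : R), is_derive y (1 : R) (F i) (F i.+1 y)) ->
  (forall y, x <= y <= x + j%:R -> `|F j y| <= B) ->
  `|\sum_(0 <= l < j.+1) 'C(j, l)%:R * (-1) ^+ (j - l) * F 0%N (x + l%:R)| <= B.
Proof.
elim: j F => [|j IHj] F dF leB.
  rewrite big_nat1 bin0 expr0 !mul1r addr0; apply: leB.
  by rewrite addr0 lexx.
rewrite finite_difference_rec.
pose G i y := F i (y + 1) - F i y.
have dG i (y : R) : is_derive y (1 : R) (G i) (G i.+1 y).
  apply: is_deriveB; rewrite -[F i.+1 (y + 1)]mulr1.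
  apply: (is_derive1_comp (g := fun y => y + 1)).
  by rewrite -[X in is_derive _ _ _ X]addr0; apply: is_deriveD.
under eq_bigr => l _ do rewrite -natr1 addrA -/(G 0%N _).
apply: (IHj G dG) => y /andP[lexy leyj].
have cF : ({within `[y, y + 1], continuous (F j)})%classic.
  apply: continuous_subspaceT => z; apply: differentiable_continuous.
  by apply/derivable1_diffP; apply: ex_derive.
have ley1 : y <= y + 1 by rewrite lerDl.
have [z] := MVT_segment ley1 (fun z _ => dF j z) cF.
rewrite in_itv /= => /andP[leyz lezy1].
rewrite /G => ->; rewrite addrAC subrr add0r mulr1; apply: leB.
rewrite (le_trans lexy leyz) (le_trans lezy1) //.
by rewrite -natr1 addrA lerD2r.
Qed.

(** The polynomial factor of the [i]-th derivative of p(y) e^(ay), which makes higher derivatives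
    algebraic. *)
Fixpoint expoly_deriv (a : R) (p : {poly R}) (i : nat) : {poly R} :=
  if i is i'.+1 then (expoly_deriv a p i')^`() + a *: expoly_deriv a p i'
  else p.

Lemma is_derive_expoly (a : R) (p : {poly R}) (i : nat) (y : R) :
  is_derive y (1 : R) (fun y => (expoly_deriv a p i).[y] * expR (a * y))
    ((expoly_deriv a p i.+1).[y] * expR (a * y)).
Proof.
have dE : is_derive y (1 : R) (fun y => expR (a * y)) (expR (a * y) * a).
  apply: (is_derive1_comp (g := fun y => a * y)).
  by rewrite -[X in is_derive _ _ _ X]mulr1; apply: is_deriveZ.
apply: trigger_derive; rewrite /= hornerD hornerZ /GRing.scale /=.
ring.
Qed.

(* The relation [(1 - c y) g' = - n c^2 y g] for [g y = (1 - c y)^n exp(n c y)],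
   differentiated [i] times. *)
Lemma expoly_deriv_rec (n : nat) (c : R) (i : nat) :
  let p := expoly_deriv (n%:R * c) ((1 - c *: 'X) ^+ n) in
  (1 - c *: 'X) * p i.+1 =
  ((i%:R * c)%:P - (n%:R * c ^+ 2) *: 'X) * p i
    - (n%:R * c ^+ 2 * i%:R) *: p i.-1.
Proof.
move=> p; elim: i => [|i IHi].
  rewrite /p /= mul0r mulr0 scale0r subr0.
  case: n @p => [|n] p.
    by rewrite !expr0 derivC !mul0r !scale0r addr0 mulr0 subr0 mul0r.
  rewrite deriv_exp derivB derivZ derivX derivC -!mul_polyC /=.
  rewrite !rmorphM rmorph_nat polyC0 /= !exprS. ring.
have pS m : p m.+1 = (p m)^`() + (n%:R * c) *: p m by [].
have dp m : (p m)^`() = p m.+1 - (n%:R * c) *: p m by rewrite pS addrK.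
(* The factor [i%:R] covers [i = 0], where [i.-1] is 0 as well. *)
have dpi : i%:R *: (p i.-1)^`() = i%:R *: (p i - (n%:R * c) *: p i.-1).
  by case: (i) => [|m]; rewrite ?scale0r // dp.
(* This operator on the polynomial factor is differentiation of its product with the exponential. *)
have dIH := congr1 (fun r => r^`() + (n%:R * c) *: r) IHi.
move: dIH; cbv beta; rewrite derivM derivB derivZ derivX derivC.
rewrite (derivB (_ * _)) derivM derivB !derivZ derivX derivC /=.
rewrite -(scalerA _ _ (p i.-1)^`()) dpi !dp -!mul_polyC.
rewrite !rmorphM !rmorph_nat /= => dIH.
apply/eqP; rewrite -subr_eq0; apply/eqP; move/eqP: dIH.
rewrite -subr_eq0 => /eqP <-; ring.
Qed.

Lemma expR_mul_1B_itv (t : R) (n : nat) :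
  t <= 1 -> 0 <= (expR t * (1 - t)) ^+ n <= 1.
Proof.
move=> t1; have ge0 : 0 <= expR t * (1 - t).
  by rewrite mulr_ge0 ?expR_ge0 ?subr_ge0.
rewrite exprn_ge0 //= exprn_ile1 // mulrC -ler_pdivlMr ?expR_gt0 //.
by rewrite div1r -expRN expR_ge1Dx.
Qed.

(** Since [1 - c * y >= 1/2], the recurrence can be solved for the next derivative at the cost of a
    factor 2. The base 3 exceeds that 2 by enough to absorb the second-order term. *)
Lemma expoly_deriv_bound (n : nat) (c d y : R) (i : nat) :
  0 <= c -> 0 <= y -> 2 * c <= d -> n%:R * c ^+ 2 <= d ^+ 2 -> y * d <= 1 ->
  `|(expoly_deriv (n%:R * c) ((1 - c *: 'X) ^+ n) i).[y]
     * expR (n%:R * c * y)| <= (3 * d) ^+ i * (i`!)%:R.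
Proof.
move=> c0 y0 c2d nc2 yd1.
set p := expoly_deriv _ _; set e := expR _.
have d0 : 0 <= d by lra.
have cy : c * y <= 1 / 2.
  have : 2 * c * y <= d * y by rewrite ler_wpM2r.
  lra.
have nc2y : n%:R * c ^+ 2 * y <= d.
  have : n%:R * c ^+ 2 * y <= d ^+ 2 * y by rewrite ler_wpM2r.
  have : d * (y * d) <= d * 1 by rewrite ler_wpM2l.
  by move=> *; nra.
have nc2y0 : 0 <= n%:R * c ^+ 2 * y by rewrite !mulr_ge0 ?exprn_ge0.
have nc20 : 0 <= n%:R * c ^+ 2 by rewrite !mulr_ge0 ?exprn_ge0.
pose g m := (p m).[y] * e.
have rec m : (1 - c * y) * g m.+1 =
    (m%:R * c - n%:R * c ^+ 2 * y) * g m - n%:R * c ^+ 2 * m%:R * g m.-1.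
  have := expoly_deriv_rec n c m; cbv zeta; rewrite -/p /g.
  move: (p m.+1) (p m) (p m.-1) => r1 r0 r => /(congr1 (fun r => r.[y])).
  rewrite -polyC1 !(hornerM, hornerD, hornerN, hornerZ, hornerX, hornerC) => Er.
  rewrite [LHS]mulrA Er; ring.
have step m (b b' : R) : `|g m| <= b -> m%:R * `|g m.-1| <= b' ->
    `|g m.+1| <= 2 * ((m.+1%:R * d) * b + d ^+ 2 * b').
  move=> gb gb'.
  have : `|(1 - c * y) * g m.+1| <= (m.+1%:R * d) * b + d ^+ 2 * b'.
    rewrite rec (le_trans (ler_normB _ _)) // lerD //.
      rewrite normrM ler_pM // (le_trans (ler_normB _ _)) //.
      rewrite (ger0_norm nc2y0) ger0_norm ?mulr_ge0 //.
      rewrite -natr1 mulrDl mul1r lerD // ler_wpM2l //; lra.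
    rewrite -mulrA normrM (ger0_norm nc20) ler_pM //.
    by rewrite normrM ger0_norm.
  rewrite normrM ger0_norm; last by lra.
  have : 1 / 2 * `|g m.+1| <= (1 - c * y) * `|g m.+1|.
    by rewrite ler_wpM2r //; lra.
  lra.
(* The recurrence reaches back two indices, so both bounds are carried along; the second includes
   the factor [i%:R] with which [g i.-1] occurs there. *)
suff : `|g i| <= (3 * d) ^+ i * (i`!)%:R /\
       i%:R * `|g i.-1| <= (3 * d) ^+ i.-1 * (i`!)%:R by case.
elim: i => [|i [IHi IHi']].
  rewrite mul0r mulr1 expr0; split=> //.
  have -> : g 0%N = (expR (c * y) * (1 - c * y)) ^+ n.
    rewrite /g /p /= horner_exp !hornerE exprMn mulrC -expRM_natl mulrA //.
  have cy1 : c * y <= 1 by lra.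
  by have /andP[ge0 le1] := expR_mul_1B_itv n cy1; rewrite ger0_norm.
split=> /=; last first.
  by rewrite factS natrM mulrCA ler_wpM2l.
case: i IHi IHi' => [|i] IHi IHi'.
  rewrite expr0 mul1r fact0 in IHi; rewrite expr1 factS mul1n fact0 mulr1.
  have := step 0%N 1 0 IHi; rewrite mul0r => /(_ (lexx _)).
  rewrite mulr0 addr0 mulr1 mul1r => /le_trans; apply.
  by rewrite ler_wpM2r // ler_nat.
apply: le_trans (step _ _ _ IHi IHi') _ => /=.
rewrite !exprS [in leRHS]factS natrM.
set T := (3 * d) ^+ i * (i.+1`!)%:R.
have T0 : 0 <= d ^+ 2 * T by rewrite !mulr_ge0 ?exprn_ge0 // mulr_ge0.
have T1 : d ^+ 2 * T <= i.+2%:R * (d ^+ 2 * T) by rewrite ler_peMl // ler1n.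
rewrite -subr_ge0 [X in 0 <= X](_ : _ =
  3 * (i.+2%:R * (d ^+ 2 * T) - d ^+ 2 * T) + d ^+ 2 * T); last first.
  rewrite /T; ring.
by rewrite addr_ge0 // mulr_ge0 // subr_ge0.
Qed.

(** * The two bounds on D(j) *)

Lemma Dnk_le_pow2 (n k j : nat) : (j <= k)%N -> `|Dnk n k j| <= 2 ^+ j :> R.
Proof.
move=> lejk; rewrite /Dnk (le_trans (ler_norm_sum _ _ _)) //.
have -> : 2 ^+ j = \sum_(0 <= l < j.+1) 'C(j, l)%:R :> R.
  rewrite -[2]/(1 + 1) exprDn big_mkord; apply: eq_bigr => l _.
  by rewrite !expr1n mulr1.
rewrite big_nat [leRHS]big_nat; apply: ler_sum => l /andP[_ lelj].
have tle1 : l%:R / k%:R <= 1 :> R.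
  have [->|k_gt0] := posnP k; first by rewrite invr0 mulr0.
  by rewrite ler_pdivrMr ?ltr0n // mul1r ler_nat (leq_trans _ lejk).
have /andP[ge0 le1] := expR_mul_1B_itv n tle1.
rewrite !normrM normrX normrN normr1 expr1n mulr1 ger0_norm //.
by rewrite (ger0_norm ge0) ler_piMr.
Qed.

Lemma Dnk_le_deriv (n k j : nat) (d : R) :
  2 / k%:R <= d -> n%:R / k%:R ^+ 2 <= d ^+ 2 -> j%:R * d <= 1 ->
  `|Dnk n k j| <= (3 * d) ^+ j * (j`!)%:R.
Proof.
move=> kd nkd jd.
pose a : R := n%:R / k%:R.
pose p := (1 - k%:R^-1 *: 'X) ^+ n : {poly R}.
(* [F i] is the [i]-th derivative of g, with [c = 1/k] in the notation of [expoly_deriv_bound]. *)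
pose F i y := (expoly_deriv a p i).[y] * expR (a * y).
have -> : Dnk n k j =
    \sum_(0 <= l < j.+1) 'C(j, l)%:R * (-1) ^+ (j - l) * F 0%N (0 + l%:R).
  apply: eq_bigr => l _; rewrite add0r /F /p /= horner_exp -polyC1.
  rewrite !(hornerD, hornerN, hornerZ, hornerX, hornerC).
  congr (_ * _); rewrite exprMn -expRM_natl mulrC [l%:R / _]mulrC.
  by rewrite /a mulrA.
apply: le_finite_difference => [i y|y /andP[y0]]; first exact: is_derive_expoly.
rewrite add0r => yj.
have d0 : 0 <= d by apply: le_trans kd; rewrite divr_ge0.
apply: expoly_deriv_bound => //; rewrite ?invr_ge0 // ?exprVn //.
by apply: le_trans jd; rewrite ler_wpM2r.
Qed.
End Analysis.

(** * The admissible range of k *)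

Section Range.
Variable R : realType.

Lemma mul_expRN_div_lt (a x y : R) : 0 < a -> 0 < x -> x < y ->
  x * expR (- (a / x)) < y * expR (- (a / y)).
Proof.
move=> a0 x0 xy; have y0 := lt_trans x0 xy.
apply: ltr_pM => //; first exact: ltW.
by rewrite ltr_expR ltrN2 ltr_pM2l // ltf_pV2.
Qed.

Lemma mul_expRN_div_le (a x y : R) : 0 < a -> 0 < x -> 0 < y ->
  (x * expR (- (a / x)) <= y * expR (- (a / y))) = (x <= y).
Proof.
move=> a0 x0 y0; apply/idP/idP; last first.
  by rewrite le_eqVlt => /predU1P[-> //|xy]; rewrite ltW // mul_expRN_div_lt.
by apply: contraTT; rewrite -!ltNge => ?; rewrite mul_expRN_div_lt.
Qed.

Lemma sqrt_expR_ln (x : R) : 0 < x -> Num.sqrt x = expR (ln x / 2).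
Proof.
move=> x0; rewrite -[in LHS](lnK (x := x)) ?posrE //.
have -> : ln x = (ln x / 2) * 2%:R by rewrite divfK.
by rewrite expRM_natr sqrtr_sqr ger0_norm ?expR_ge0 // mulfK.
Qed.

(** [lam n k] is the value at [k] of the increasing map x e^(-n/x); apply this map to both ends of
    the range. *)
Lemma in_range_lam (n k : nat) : (1 < n)%N -> (0 < k)%N ->
  in_range R n k <-> lam_in_range R n k.
Proof.
move=> n1 k0; have n0 : 0 < n%:R :> R by rewrite ltr0n ltnW.
have kR0 : 0 < k%:R :> R by rewrite ltr0n.
have L0 : 0 < ln n%:R :> R by rewrite ln_gt0 // ltr1n.
have L60 : 0 < ln n%:R + 6 :> R by rewrite addr_gt0.
rewrite /in_range /lam_in_range.
rewrite -(@mul_expRN_div_le n%:R (n%:R / ln n%:R)) ?divr_gt0 //.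
rewrite -(@mul_expRN_div_le n%:R k%:R) ?divr_gt0 ?mulr_gt0 //.
have -> : n%:R / (n%:R / ln n%:R) = ln n%:R :> R.
  by field; rewrite !gt_eqF.
have -> : n%:R / (2 * n%:R / (ln n%:R + 6)) = ln n%:R / 2 + 1 * 3%:R :> R.
  by field; rewrite !gt_eqF.
rewrite !expRN expRD expRM_natr -sqrt_expR_ln // lnK ?posrE //.
have -> : n%:R / ln n%:R / n%:R = 1 / ln n%:R :> R.
  by field; rewrite !gt_eqF.
have s0 : 0 < Num.sqrt n%:R :> R by rewrite sqrtr_gt0.
have e0 : 0 < expR 1 :> R := expR_gt0 1.
have -> : 2 * n%:R / (ln n%:R + 6) / (Num.sqrt n%:R * expR 1 ^+ 3) =
    2 / expR 1 ^+ 3 * (Num.sqrt n%:R / (ln n%:R + 6)) :> R.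
  rewrite -[X in 2 * X](sqr_sqrtr (ltW n0)); field.
  by rewrite !gt_eqF.
by rewrite /lam expRN.
Qed.

Lemma in_range_bounds (n k : nat) : (0 < n)%N -> (0 < k)%N -> in_range R n k ->
  [/\ (1 < n)%N, 6 <= ln n%:R :> R, n%:R <= k%:R * ln n%:R :> R
    & 6 <= n%:R / k%:R :> R].
Proof.
move=> n0 k0 [lo hi]; have kR0 : 0 < k%:R :> R by rewrite ltr0n.
have nR0 : 0 < n%:R :> R by rewrite ltr0n.
have n1 : (1 < n)%N.
  rewrite ltnNge; apply/negP => n1.
  have n_eq1 : n = 1%N by apply/eqP; rewrite eqn_leq n1 n0.
  move: hi; rewrite n_eq1 ln1 add0r => hi.
  have : 1 <= k%:R :> R by rewrite ler1n.
  by lra.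
have L0 : 0 < ln n%:R :> R by rewrite ln_gt0 // ltr1n.
have L60 : 0 < ln n%:R + 6 :> R by rewrite addr_gt0.
(* The lower end of the range cannot exceed the upper one. *)
have L6 : 6 <= ln n%:R :> R.
  have := le_trans lo hi.
  rewrite ler_pdivrMr // mulrAC ler_pdivlMr // => le_n.
  have : n%:R * (ln n%:R + 6) <= n%:R * (2 * ln n%:R) :> R.
    by apply: le_trans le_n _; rewrite mulrCA mulrA.
  by rewrite ler_pM2l //; lra.
split=> //; first by rewrite -ler_pdivrMr.
rewrite ler_pdivlMr //; rewrite ler_pdivlMr // in hi.
have : k%:R * 6 <= k%:R * ln n%:R :> R by rewrite ler_pM2l.
lra.
Qed.

(** * Bounding the terms of the identity *)

Lemma natr_expn_fact_le (j : nat) : j%:R ^+ j <= expR 1 ^+ j * (j`!)%:R :> R.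
Proof.
case: j => [|j]; first by rewrite !expr0 fact0 mul1r.
rewrite -ler_pdivrMr ?ltr0n ?fact_gt0 // -expRM_natr mul1r.
by apply: le_trans (expR_ge1Dxn j (ler0n R j.+1)); rewrite lerDr.
Qed.

Lemma bin_expr_le (k j : nat) (x : R) : 0 <= x ->
  'C(k, j)%:R * x ^+ j <= (k%:R * x) ^+ j / (j`!)%:R.
Proof.
move=> x0; rewrite ler_pdivlMr ?ltr0n ?fact_gt0 // mulrAC exprMn.
rewrite ler_wpM2r ?exprn_ge0 // -natrM -natrX ler_nat bin_ffact.
by elim: j => // j IHj; rewrite ffactnSr expnSr leq_mul // leq_subr.
Qed.

Lemma term_le (n k j : nat) : (0 < n)%N -> (0 < k)%N -> in_range R n k ->
  (j <= k)%N ->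
  `|'C(k, j)%:R * (- Lam n k) ^+ j * Dnk n k j| <=
  (7 / 3 * expR 1 * (lam n k * ln n%:R / Num.sqrt n%:R)) ^+ j :> R.
Proof.
move=> n0 k0 nk jk; have [_ L6 nkL nk6] := in_range_bounds n0 k0 nk.
have nR0 : 0 < n%:R :> R by rewrite ltr0n.
have kR0 : 0 < k%:R :> R by rewrite ltr0n.
set L : R := ln n%:R in L6 nkL *; set r := Num.sqrt n%:R.
have r0 : 0 < r by rewrite sqrtr_gt0.
have rr : r ^+ 2 = n%:R by rewrite sqr_sqrtr // ltW.
pose d := L / r; have d0 : 0 < d by rewrite divr_gt0 //; lra.
(* From [n/k >= 6] and e^t >= 1 + t; hence the factor 1 / (1 - 1/7) = 7/6 in [kLam]. *)
have q7 : expR (- (n%:R / k%:R)) <= 1 / 7 :> R.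
  rewrite expRN div1r lef_pV2 ?posrE ?expR_gt0 //.
  by apply: le_trans (expR_ge1Dx _); lra.
have q0 : 0 < expR (- (n%:R / k%:R)) :> R := expR_gt0 _.
have lam0 : 0 <= lam n k :> R by rewrite mulr_ge0.
have Lam0 : 0 <= Lam n k :> R by rewrite divr_ge0 //; lra.
have kLam : k%:R * Lam n k <= 7 / 6 * lam n k :> R.
  rewrite /Lam /lam; set q := expR _ in q7 q0 *.
  rewrite mulrA ler_pdivrMr; last by lra.
  have : 0 <= k%:R * q * (1 / 7 - q) by rewrite !mulr_ge0 //; lra.
  nra.
have e0 : 0 <= expR 1 :> R := expR_ge0 1.
have e2 : 2 <= expR 1 :> R by apply: le_trans (expR_ge1Dx _).
have -> : lam n k * L / r = lam n k * d by rewrite mulrA.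
have jf0 : 0 < (j`!)%:R :> R by rewrite ltr0n fact_gt0.
have coef_le : 'C(k, j)%:R * Lam n k ^+ j <=
    (7 / 6 * lam n k) ^+ j / (j`!)%:R :> R.
  apply: le_trans (bin_expr_le _ _ Lam0) _.
  by rewrite ler_pM2r ?invr_gt0 // lerXn2r // nnegrE ?mulr_ge0.
(* Both regimes end here: [b = 3 * d] for small [j], and [b = 2 * expR 1 * d] for large [j], which
   attains the constant 7e/3 exactly. *)
have bound b : 0 <= b -> `|Dnk n k j| <= b ^+ j * (j`!)%:R ->
    7 / 6 * b <= 7 / 3 * expR 1 * d ->
  `|'C(k, j)%:R * (- Lam n k) ^+ j * Dnk n k j| <=
  (7 / 3 * expR 1 * (lam n k * d)) ^+ j.
  move=> b0 Db bd; rewrite !normrM normrX normrN (ger0_norm (ler0n _ _)) (ger0_norm Lam0).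
  apply: le_trans (ler_pM _ _ coef_le Db) _ => //.
    by rewrite mulr_ge0 ?exprn_ge0.
  rewrite mulrA mulrAC divfK ?gt_eqF // -exprMn lerXn2r ?nnegrE //.
  - by rewrite !mulr_ge0.
  - by apply: mulr_ge0; [lra | apply: mulr_ge0; [|exact: ltW]].
  rewrite mulrAC [leRHS]mulrCA [leRHS]mulrC.
  exact: ler_wpM2r.
have [jd|jd] := leP (j%:R * d) 1.
  apply: (bound (3 * d)).
  - by rewrite mulr_ge0 // ltW.
  - apply: Dnk_le_deriv => //.
      (* The claim is 2 sqrt n <= k log n: indeed 2 sqrt n <= n, as n > log n >= 6, and n <= k log
         n. *)
      rewrite ler_pdivrMr // /d mulrAC ler_pdivlMr // mulrC.
      have r2 : 2 <= r.
        rewrite -ler_sqr ?nnegrE //; last exact: ltW.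
        rewrite rr; have := ln_sublinear nR0; rewrite -/L; lra.
      have : r * 2 <= r * r by rewrite ler_pM2l.
      by rewrite -expr2 rr; lra.
    rewrite /d expr_div_n rr ler_pdivrMr ?exprn_gt0 // mulrAC ler_pdivlMr //.
    by rewrite -expr2 -exprMn lerXn2r // ?nnegrE ?mulr_ge0 // 1?mulrC //; lra.
  - have : 2 * d <= expR 1 * d by rewrite ler_pM2r.
    by lra.
apply: (bound (2 * expR 1 * d)) => //.
- by apply: mulr_ge0; [lra | exact: ltW].
(* As [j * d > 1], 2^j is at most (2jd)^j, and j^j <= e^j j! supplies the factorial. *)
- apply: le_trans (Dnk_le_pow2 R n jk) _.
  rewrite -mulrA exprMn -mulrA ler_peMr ?exprn_ge0 //.
  rewrite exprMn mulrAC.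
  apply: le_trans (ler_wpM2r _ (natr_expn_fact_le j)); last first.
    by rewrite exprn_ge0 // ltW.
  by rewrite -exprMn exprn_ege1 // ltW.
- by rewrite le_eqVlt; apply/orP; left; apply/eqP; field.
Qed.

(** Keeps the geometric ratio uniformly below 1. It is at most 14 / (3 e^2), for which e >= 2 would
    be too weak; e >= (1 + 1/2)^2 = 9/4 suffices. *)
Lemma ratio_le (n k : nat) : (0 < n)%N -> (0 < k)%N -> in_range R n k ->
  7 / 3 * expR 1 * (lam n k * ln n%:R / Num.sqrt n%:R) <= 19 / 20 :> R.
Proof.
move=> n0 k0 nk; have [n1 L6 _ _] := in_range_bounds n0 k0 nk.
have [_ lam_le] := (in_range_lam n1 k0).1 nk.
set L : R := ln n%:R in L6 lam_le *; set r := Num.sqrt n%:R in lam_le *.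
have r0 : 0 < r by rewrite sqrtr_gt0 ltr0n.
have e94 : 9 / 4 <= expR 1 :> R.
  have -> : 1 = 1 / 2 * 2%:R :> R by field.
  rewrite expRM_natr; have : 1 + 1 / 2 <= expR (1 / 2) :> R := expR_ge1Dx _.
  by move=> *; nra.
set e := expR 1 in lam_le e94 *.
have x_le : lam n k * L / r <= 2 / e ^+ 3.
  rewrite ler_pdivrMr //; apply: le_trans (ler_wpM2r _ lam_le) _; first by lra.
  rewrite -!mulrA ler_pM2l // ler_pM2l ?invr_gt0 ?exprn_gt0 //; last by lra.
  by rewrite ler_piMr // ?(ltW r0) // mulrC ler_pdivrMr; lra.
apply: (@le_trans _ _ (7 / 3 * e * (2 / e ^+ 3))).
  by rewrite ler_pM2l // mulr_gt0 //; lra.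
have -> : 7 / 3 * e * (2 / e ^+ 3) = 14 / 3 / e ^+ 2 by field; lra.
by rewrite ler_pdivrMr ?exprn_gt0 //; [nra|lra].
Qed.
End Range.

(** * Summing the tail *)

Lemma sum_geometric_le (R : realFieldType) (y : R) (s m : nat) :
  0 <= y < 1 -> \sum_(s <= j < m) y ^+ j <= y ^+ s / (1 - y).
Proof.
move=> /andP[y0 y1]; have y10 : 0 < 1 - y by rewrite subr_gt0.
rewrite ler_pdivlMr // mulr_suml.
have [lesm|ltms] := leqP s m; last by rewrite big_geq ?exprn_ge0 // ltnW.
under eq_bigr => j _ do rewrite mulrBr mulr1 -exprSr -opprB.
by rewrite sumrN telescope_sumr // opprB gerBl exprn_ge0.
Qed.

Theorem theorem3 (R : realType) :
  (forall n k : nat, (1 < n)%N -> (0 < k)%N ->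
     (in_range R n k <-> lam_in_range R n k)) /\
  (forall s : nat, (1 <= s)%N ->
     exists C : R, 0 < C /\
     forall n k : nat, (0 < n)%N -> (0 < k)%N -> in_range R n k ->
     exists E : R,
       `|E| <= C * (lam n k * ln n%:R / Num.sqrt n%:R) ^+ s /\
       surj_prob n k =
         (1 - lam n k / k%:R) ^+ k *
         (1 + \sum_(1 <= j < s) ('C(k, j))%:R * (- Lam n k) ^+ j * Dnk n k j
            + E)).
Proof.
split=> [n k|s s1]; first exact: in_range_lam.
(* 20 is 1 / (1 - 19/20), from the geometric tail. *)
exists (20 * (7 / 3 * expR 1) ^+ s); split.
  by rewrite mulr_gt0 ?exprn_gt0 // mulr_gt0 ?expR_gt0.
move=> n k n0 k0 nk; set x := lam n k * _ / _.
pose f j : R := 'C(k, j)%:R * (- Lam n k) ^+ j * Dnk n k j.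
pose y := 7 / 3 * expR 1 * x.
have y1 : y <= 19 / 20 := ratio_le n0 k0 nk.
have y0 : 0 <= y.
  rewrite !mulr_ge0 ?invr_ge0 ?sqrtr_ge0 ?expR_ge0 //.
  by rewrite ln_ge0 // ler1n.
(* The end [s + k.+1] allows splitting at [s] even when [s > k]; the terms with [j > k] vanish. *)
exists (\sum_(s <= j < s + k.+1) f j); split.
  apply: le_trans (ler_norm_sum _ _ _) _.
  apply: (@le_trans _ _ (\sum_(s <= j < s + k.+1) y ^+ j)).
    apply: ler_sum => j _; have [jk|kj] := leqP j k; first exact: term_le.
    by rewrite /f bin_small // !mul0r normr0 exprn_ge0.
  have y01 : 0 <= y < 1 by rewrite y0 (le_lt_trans y1) //; lra.
  apply: le_trans (sum_geometric_le _ _ y01) _.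
  rewrite -[leRHS]mulrA -exprMn -/y [leRHS]mulrC.
  rewrite ler_wpM2l ?exprn_ge0 // -[leRHS]invrK lef_pV2 ?posrE; lra.
rewrite surj_prob_Dnk //; congr (_ * _).
have -> : \sum_(0 <= j < k.+1) f j = \sum_(0 <= j < s + k.+1) f j.
  rewrite [RHS](big_cat_nat _ (n := k.+1)) ?leq_addl //=.
  rewrite [X in _ + X]big_nat [X in _ + X]big1 ?addr0 // => j /andP[kj _].
  by rewrite /f bin_small // !mul0r.
rewrite (big_cat_nat _ (n := s)) ?leq_addr //= big_ltn //.
by rewrite {1}/f bin0 expr0 !mul1r /Dnk big_nat1 !mul0r expR0 subr0 !mul1r expr1n.
Qed.
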